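(* Let $g$ be a (generally non-convex) differentiable function on $S_n(1)\times\mathbb{R}_+^m$ with $\|\nabla g(x)-\nabla g(y)\|_*\le L_g\|x-y\|$ for all $x,y\in S_n(1)\times\mathbb{R}^m_+$, and let $L_g\le\mu_1$ and $L_g\le\mu_2$. For $x=(z_x,p_x)\in S_n(1)\times\mathbb{R}^m_+$ put $$f_{\mu_1,\mu_2}(x)=g(x)+\mu_1\sum_{k=1}^n (z_x)_k\ln (z_x)_k+\frac{\mu_2}{2}\|p_x\|_2^2 .$$ Then $$\psi_\delta(x,y)=\langle\nabla g(y),x-y\rangle-L_g\,KL(z_x|z_y)-\frac{L_g}{2}\|p_x-p_y\|_2^2+\mu_1\bigl(KL(z_x|\mathbf 1)-KL(z_y|\mathbf 1)\bigr)+\frac{\mu_2}{2}\bigl(\|p_x\|_2^2-\|p_y\|_2^2\bigr)$$ is a $(0,2L_g)$-model of $f_{\mu_1,\mu_2}$ with respect to the Bregman divergence $V[y](x)=KL(z_x|z_y)+\frac12\|p_x-p_y\|_2^2$ (at every point $y=(z_y,p_y)\in S_n(1)\times\mathbb{R}_+^m$ with all entries of $z_y$ positive).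
   Context: $S_n(1)$ is the standard simplex in $\mathbb{R}^n$, $\mathbb{R}_+^m$ the non-negative orthant, $\mathbf 1=(1,\dots,1)^T$, $KL(z|t)=\sum_{k=1}^n z_k\ln(z_k/t_k)$ (with $0\ln0=0$), so $KL(z|\mathbf 1)=\sum_k z_k\ln z_k$. For $x=(z,p)\in\mathbb{R}^n\times\mathbb{R}^m$, $\|x\|^2=\|z\|_1^2+\|p\|_2^2$ with $\|\cdot\|_1$ the $\ell_1$ norm and $\|\cdot\|_2$ the Euclidean norm; $\|\cdot\|_*$ is the dual norm of $\|\cdot\|$. $(\delta,L)$-model (here with $\delta=0$ allowed): a function $\psi_\delta(x,y)$, convex in $x\in Q$ with $\psi_\delta(x,x)=0$, is a $(\delta,L)$-model of $f$ at $y$ with respect to $V$ if for all $x\in Q$: $0\le f(x)-(f(y)+\psi_\delta(x,y))\le LV[y](x)+\delta$. Here $Q=S_n(1)\times\mathbb{R}^m_+$. *)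

(* Defs.v *)
From HB Require Import structures.
From mathcomp Require Import all_boot all_order all_algebra.
From mathcomp Require Import all_classical all_reals all_analysis.

Set Implicit Arguments.
Unset Strict Implicit.
Unset Printing Implicit Defensive.

Import Order.TTheory GRing.Theory Num.Theory.
Import numFieldNormedType.Exports.

Local Open Scope classical_set_scope.
Local Open Scope ring_scope.

Definition simplex (R : realType) (n : nat) : set 'rV[R]_n :=
  [set z | (forall k, 0 <= z 0 k) /\ \sum_k z 0 k = 1].
Arguments simplex : clear implicits.

Definition orthant (R : realType) (m : nat) : set 'rV[R]_m :=
  [set p | forall j, 0 <= p 0 j].
Arguments orthant : clear implicits.

(* S_n(1) x R_+^m *)
Definition domQ (R : realType) (n m : nat) : set ('rV[R]_n * 'rV[R]_m) :=
  simplex R n `*` orthant R m.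
Arguments domQ : clear implicits.

Definition norm1 (R : realType) (n : nat) (z : 'rV[R]_n) : R :=
  \sum_k `|z 0 k|.

Definition norm2 (R : realType) (m : nat) (p : 'rV[R]_m) : R :=
  Num.sqrt (\sum_j p 0 j ^+ 2).

(* The library's `|x| on the product is the max norm, hence a separate name. *)
Definition pnorm (R : realType) (n m : nat) (x : 'rV[R]_n * 'rV[R]_m) : R :=
  Num.sqrt (norm1 x.1 ^+ 2 + norm2 x.2 ^+ 2).

Definition inner (R : realType) (n m : nat) (s x : 'rV[R]_n * 'rV[R]_m) : R :=
  \sum_k s.1 0 k * x.1 0 k + \sum_j s.2 0 j * x.2 0 j.

(* The set is nonempty and bounded, so sup is the actual supremum. *)
Definition dual_norm (R : realType) (n m : nat) (s : 'rV[R]_n * 'rV[R]_m) : R :=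
  sup [set inner s x | x in [set x | pnorm x <= 1]].

(* v is a gradient of g at y relative to Q: Frechet expansion along Q. No
   neighbourhood of Q is involved since the simplex has empty interior; if g is
   differentiable at y in the ambient space, its gradient qualifies. As all
   norms are equivalent here, the max norm used by =o_ is harmless. *)
Definition is_gradient_on (R : realType) (n m : nat)
    (Q : set ('rV[R]_n * 'rV[R]_m)) (g : 'rV[R]_n * 'rV[R]_m -> R)
    (y v : 'rV[R]_n * 'rV[R]_m) : Prop :=
  ((fun x => g x - g y - inner v (x - y)) : _ -> R^o)
    =o_ (within Q (nbhs y)) (fun x => x - y).

(* Terms with z_k = 0 vanish whatever the value of ln; only meaningful when
   z_k > 0 implies t_k > 0. *)
Definition KL (R : realType) (n : nat) (z t : 'rV[R]_n) : R :=
  \sum_k z 0 k * ln (z 0 k / t 0 k).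

(* psi is a (delta, L)-model of f at y with respect to V on Q, where V y x
   stands for V[y](x). *)
Definition is_model (R : realType) (E : lmodType R) (Q : set E)
    (V : E -> E -> R) (delta L : R) (f : E -> R) (psi : E -> E -> R) (y : E)
    : Prop :=
  [/\ convex_function Q (psi^~ y),
      forall x, x \in Q -> psi x x = 0 &
      forall x, x \in Q ->
        0 <= f x - (f y + psi x y) <= L * V y x + delta].

(* V[y](x), the Bregman divergence of sum_k z_k ln z_k + |p|_2^2 / 2 *)
Definition bregman (R : realType) (n m : nat) (y x : 'rV[R]_n * 'rV[R]_m) : R :=
  KL x.1 y.1 + norm2 (x.2 - y.2) ^+ 2 / 2.

Definition fmu (R : realType) (n m : nat) (g : 'rV[R]_n * 'rV[R]_m -> R)
    (mu1 mu2 : R) (x : 'rV[R]_n * 'rV[R]_m) : R :=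
  g x + mu1 * (\sum_k x.1 0 k * ln (x.1 0 k)) + mu2 / 2 * norm2 x.2 ^+ 2.

Definition psimu (R : realType) (n m : nat)
    (gradg : 'rV[R]_n * 'rV[R]_m -> 'rV[R]_n * 'rV[R]_m)
    (Lg mu1 mu2 : R) (x y : 'rV[R]_n * 'rV[R]_m) : R :=
  inner (gradg y) (x - y) - Lg * KL x.1 y.1
  - Lg / 2 * norm2 (x.2 - y.2) ^+ 2
  + mu1 * (KL x.1 (const_mx 1) - KL y.1 (const_mx 1))
  + mu2 / 2 * (norm2 x.2 ^+ 2 - norm2 y.2 ^+ 2).

(* Main.v *)
Require Import Defs.
From mathcomp Require Import all_boot all_order all_algebra.
From mathcomp Require Import all_classical all_reals all_analysis.
From mathcomp Require Import ring lra.

Set Implicit Arguments.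
Unset Strict Implicit.
Unset Printing Implicit Defensive.

Import Order.TTheory GRing.Theory Num.Theory.
Import numFieldNormedType.Exports.

Local Open Scope classical_set_scope.
Local Open Scope ring_scope.

(** Put D = g x - g y - <grad g y, x - y>.  All entropy and square terms of
    f_mu and psi cancel except those carrying Lg, so that
    f_mu x - (f_mu y + psi x y) = D + Lg * V[y](x), and the model inequality
    says exactly |D| <= Lg * V[y](x).  Two bounds give it:

    - |D| <= Lg / 2 * ||x - y||^2, because the gradient is Lg-Lipschitz
      ([descent]); Q has empty interior and the gradient is only relative to Q,
      so everything happens on the segment from y to x, where the mean value
      theorem applies ([line_descent]);
    - ||x - y||^2 / 2 <= V[y](x), which is Pinsker's inequality on the simplex
      component ([pinsker]) and an equality on the Euclidean one.

    Chaining them needs Lg >= 0, which the Lipschitz hypothesis forces as soon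
    as x differs from y; for x = y both sides vanish.

    For convexity, ln (z / t) = ln z - ln t turns psi(., y) into an affine
    function plus (mu1 - Lg) * sum z ln z plus (mu2 - Lg) / 2 * |p|^2
    ([psimu_split]), with nonnegative coefficients since Lg <= mu1, mu2. *)

(** * Pinsker's inequality *)

Lemma is_derive_ln_sub_pade (R : realType) (x : R) : 0 < x ->
  is_derive x 1
    (fun u : R => ln u - (u - 1) * (5 * u + 1) * (2 * u * (u + 2))^-1)
    ((x - 1) ^+ 3 / (x * (x + 2)) ^+ 2).
Proof.
move=> x0.
have x20 : 2 * x * (x + 2) != 0 by rewrite !mulf_neq0 ?lt0r_neq0//; lra.
have dln := is_derive1_ln x0.
have dden : is_derive x 1 (fun u : R => 2 * u * (u + 2)) (4 * x + 4).
  by apply: is_derive_eq; rewrite /GRing.scale/=; ring.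
have dnum : is_derive x 1 (fun u : R => (u - 1) * (5 * u + 1)) (10 * x - 4).
  by apply: is_derive_eq; rewrite /GRing.scale/=; ring.
have dinv := is_deriveV x20.
apply: is_derive_eq; rewrite /GRing.scale/=.
by field; apply/andP; split; apply: lt0r_neq0; lra.
Qed.

(** The difference of the two sides vanishes at 1, and its derivative has the
    sign of u - 1, so 1 is its minimum. The rational function is the one that
    makes [chi2_le_entropy] hold. *)
Lemma pade_le_ln (R : realType) (u : R) : 0 < u ->
  (u - 1) * (5 * u + 1) / (2 * u * (u + 2)) <= ln u.
Proof.
move=> u0; rewrite -subr_ge0.
pose F (v : R) := ln v - (v - 1) * (5 * v + 1) * (2 * v * (v + 2))^-1.
rewrite -/(F u).
have F1 : F 1 = 0 by rewrite /F ln1 subrr !mul0r subrr.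
pose F' (v : R) := (v - 1) ^+ 3 / (v * (v + 2)) ^+ 2.
have dF (x : R) : 0 < x -> is_derive x 1 F (F' x).
  exact: is_derive_ln_sub_pade.
have cF (a b : R) : 0 < a -> {within `[a, b], continuous F}.
  move=> a0; apply: derivable_within_continuous => x.
  rewrite in_itv/= => /andP[ax _].
  by have [] := dF x (lt_le_trans a0 ax).
have [u1|u1|->] := ltgtP u 1; last by rewrite F1.
- have dFu x : x \in `]u, 1[ -> is_derive x 1 F (F' x).
    by rewrite in_itv/= => /andP[ux _]; exact: dF (lt_trans u0 ux).
  have [c] := MVT u1 dFu (cF _ _ u0).
  rewrite in_itv/= => /andP[uc c1]; rewrite F1 sub0r => /eqP.
  rewrite eqr_oppLR => /eqP ->; rewrite oppr_ge0.
  rewrite mulr_le0_ge0 ?subr_ge0 ?(ltW u1)// mulr_le0_ge0 ?invr_ge0 ?sqr_ge0//.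
  by rewrite exprS mulr_le0_ge0 ?sqr_ge0// subr_le0 ltW.
- have dFu x : x \in `]1, u[ -> is_derive x 1 F (F' x).
    by rewrite in_itv/= => /andP[ux _]; exact: dF (lt_trans ltr01 ux).
  have [c] := MVT u1 dFu (cF _ _ ltr01).
  rewrite in_itv/= => /andP[c1 cu]; rewrite F1 subr0 => ->.
  rewrite mulr_ge0 ?subr_ge0 ?(ltW u1)// mulr_ge0 ?invr_ge0 ?sqr_ge0//.
  by rewrite exprn_ge0// subr_ge0 ltW.
Qed.

(** Termwise form of Pinsker's inequality: for z > 0 it is [pade_le_ln] at
    u = z / t, multiplied by z. The weights (2 * z + 4 * t) / 3 sum to 2 over two points of the
    simplex, while the right-hand sides sum to KL. *)
Lemma chi2_le_entropy (R : realType) (z t : R) : 0 <= z -> 0 < t ->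
  3 * (z - t) ^+ 2 / (2 * z + 4 * t) <= z * ln (z / t) - z + t.
Proof.
rewrite le_eqVlt => /predU1P[<- t0|z0 t0].
  rewrite mul0r mulr0 subr0 !add0r sqrrN.
  rewrite ler_pdivrMr; last lra.
  by nra.
have := pade_le_ln (divr_gt0 z0 t0); rewrite -(ler_pM2l z0) => pade.
have -> : 3 * (z - t) ^+ 2 / (2 * z + 4 * t) =
    z * ((z / t - 1) * (5 * (z / t) + 1) / (2 * (z / t) * (z / t + 2))) - z + t.
  by field; repeat (apply/andP; split); apply: lt0r_neq0; lra.
lra.
Qed.

Lemma KL_id (R : realType) (n : nat) (z : 'rV[R]_n) : KL z z = 0.
Proof.
rewrite /KL big1// => k _.
have [->|z0] := eqVneq (z 0 k) 0; first by rewrite mul0r.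
by rewrite divff// ln1 mulr0.
Qed.

(** With d_k = |z_k - t_k|, weights w_k = (2 z_k + 4 t_k) / 3 and a = sum d_k,
    Cauchy-Schwarz a^2 <= (sum w_k) (sum d_k^2 / w_k) is used in its termwise
    form a d_k - a^2 w_k / 4 <= d_k^2 / w_k, which sums to a^2 / 2 on the left
    because the w_k sum to 2. *)
Lemma pinsker (R : realType) (n : nat) (z t : 'rV[R]_n) :
  z \in simplex R n -> t \in simplex R n -> (forall k, 0 < t 0 k) ->
  norm1 (z - t) ^+ 2 / 2 <= KL z t.
Proof.
rewrite !inE => -[z0 z1] [t0' t1] t0.
(* z and t have the same total mass *)
have -> : KL z t = \sum_k (z 0 k * ln (z 0 k / t 0 k) - z 0 k + t 0 k).
  by rewrite big_split/= sumrB z1 t1 subrK.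
set a := norm1 (z - t).
have -> : a ^+ 2 / 2 =
    \sum_k (a * `|(z - t) 0 k| - a ^+ 2 / 4 * ((2 * z 0 k + 4 * t 0 k) / 3)).
  rewrite sumrB -mulr_sumr -/(norm1 _) -/a -mulr_sumr -mulr_suml.
  by rewrite big_split/= -!mulr_sumr z1 t1; field.
apply: ler_sum => k _; apply: le_trans (chi2_le_entropy (z0 k) (t0 k)).
rewrite !mxE -[(z 0 k - t 0 k) ^+ 2]real_normK ?num_real//; set d := `|_|.
have w0 : 0 < 2 * z 0 k + 4 * t 0 k by have := z0 k; have := t0 k; lra.
move: w0; set w := 2 * _ + _ => w0.
rewrite ler_pdivlMr//.
rewrite -subr_ge0.
have -> : 3 * d ^+ 2 - (a * d - a ^+ 2 / 4 * (w / 3)) * w =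
  (6 * d - a * w) ^+ 2 / 12 by field.
by rewrite mulr_ge0 ?sqr_ge0// invr_ge0.
Qed.

(** * Convexity of the square and of x ln x *)

Lemma convex_sqr (R : realType) (s a b : R) : 0 <= s <= 1 ->
  (s * a + (1 - s) * b) ^+ 2 <= s * a ^+ 2 + (1 - s) * b ^+ 2.
Proof.
move=> /andP[s0 s1]; rewrite -subr_ge0.
have -> : s * a ^+ 2 + (1 - s) * b ^+ 2 - (s * a + (1 - s) * b) ^+ 2 =
    s * (1 - s) * (a - b) ^+ 2 by ring.
by rewrite mulr_ge0 ?sqr_ge0// mulr_ge0 ?subr_ge0.
Qed.

(** This is ln (c / x) <= c / x - 1, multiplied by x. *)
Lemma xlnx_tangent (R : realType) (c x : R) : 0 < c -> 0 <= x ->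
  x * ln c + x - c <= x * ln x.
Proof.
move=> c0; rewrite le_eqVlt => /predU1P[<-|x0].
  by rewrite !mul0r add0r sub0r oppr_le0 ltW.
have : ln (c / x) <= c / x - 1.
  rewrite -[X in ln X](subrK 1) addrC; apply: le_ln1Dx.
  by have := divr_gt0 c0 x0; lra.
rewrite ln_div ?posrE// -(ler_pM2l x0).
have -> : x * (c / x - 1) = c - x by field; rewrite lt0r_neq0.
lra.
Qed.

(** Weighted sum of the tangent inequalities at the convex combination c. The
    tangent does not exist when c = 0, but then both weighted points are 0. *)
Lemma convex_xlnx (R : realType) (s a b : R) :
  0 <= s <= 1 -> 0 <= a -> 0 <= b ->
  (s * a + (1 - s) * b) * ln (s * a + (1 - s) * b) <=
  s * (a * ln a) + (1 - s) * (b * ln b).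
Proof.
move=> /andP[s0 s1] a0 b0; set c := s * a + _.
have sa0 : 0 <= s * a by rewrite mulr_ge0.
have sb0 : 0 <= (1 - s) * b by rewrite mulr_ge0 ?subr_ge0.
have : 0 <= c by rewrite addr_ge0.
rewrite le_eqVlt => /predU1P[c0|c0].
  have sa : s * a = 0 by move: c0; rewrite /c; lra.
  have sb : (1 - s) * b = 0 by move: c0; rewrite /c; lra.
  by rewrite -c0 !mulrA sa sb !mul0r addr0.
have ta := ler_wpM2l s0 (xlnx_tangent c0 a0).
have s1' : 0 <= 1 - s by lra.
have tb := ler_wpM2l s1' (xlnx_tangent c0 b0).
apply: le_trans (lerD ta tb).
rewrite le_eqVlt; apply/orP; left; apply/eqP.
by rewrite /c; ring.
Qed.

(** * The norm on the product and its dual *)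

Section Pairing.
Variables (R : realType) (n m : nat).
Implicit Types (s d x y : 'rV[R]_n * 'rV[R]_m) (a : R).

Lemma innerDr s x y : inner s (x + y) = inner s x + inner s y.
Proof.
rewrite /inner addrACA -!big_split/=; congr (_ + _);
  by apply: eq_bigr => k _; rewrite mxE mulrDr.
Qed.

Lemma innerZr s a x : inner s (a *: x) = a * inner s x.
Proof.
rewrite /inner mulrDr !mulr_sumr; congr (_ + _);
  by apply: eq_bigr => k _; rewrite mxE mulrCA.
Qed.

Lemma innerC s x : inner s x = inner x s.
Proof.
by rewrite /inner; congr (_ + _); apply: eq_bigr => k _; rewrite mulrC.
Qed.

Lemma innerNr s x : inner s (- x) = - inner s x.
Proof. by rewrite -scaleN1r innerZr mulN1r. Qed.

Lemma innerBr s x y : inner s (x - y) = inner s x - inner s y.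
Proof. by rewrite innerDr innerNr. Qed.

Lemma innerBl s x y : inner (x - y) s = inner x s - inner y s.
Proof. by rewrite innerC innerBr !(innerC s). Qed.

Lemma norm2_sqr (p : 'rV[R]_m) : norm2 p ^+ 2 = \sum_j p 0 j ^+ 2.
Proof. by rewrite sqr_sqrtr// sumr_ge0// => j _; rewrite sqr_ge0. Qed.

Lemma pnorm_sqr x : pnorm x ^+ 2 = norm1 x.1 ^+ 2 + norm2 x.2 ^+ 2.
Proof. by rewrite sqr_sqrtr// addr_ge0// sqr_ge0. Qed.

Lemma pnorm_ge0 x : 0 <= pnorm x.
Proof. exact: sqrtr_ge0. Qed.

Lemma pnormZ a x : pnorm (a *: x) = `|a| * pnorm x.
Proof.
apply/eqP; rewrite -(@eqrXn2 _ 2)// ?mulr_ge0 ?pnorm_ge0//; apply/eqP.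
rewrite exprMn !pnorm_sqr !norm2_sqr mulrDr -exprMn; congr (_ ^+ 2 + _).
  by rewrite /norm1 mulr_sumr; apply: eq_bigr => k _; rewrite mxE normrM.
rewrite mulr_sumr; apply: eq_bigr => j _.
by rewrite mxE exprMn real_normK ?num_real.
Qed.

Lemma norm_coord1_le x k : `|x.1 0 k| <= pnorm x.
Proof.
rewrite -(@ler_pXn2r _ 2) ?nnegrE ?pnorm_ge0// pnorm_sqr.
rewrite -[leLHS]addr0 lerD ?sqr_ge0// lerXn2r ?nnegrE ?sumr_ge0//.
by rewrite /norm1 (bigD1 k)//= lerDl sumr_ge0.
Qed.

Lemma norm_coord2_le x j : `|x.2 0 j| <= pnorm x.
Proof.
rewrite -(@ler_pXn2r _ 2) ?nnegrE ?pnorm_ge0// pnorm_sqr norm2_sqr.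
rewrite real_normK ?num_real// -[leLHS]add0r lerD ?sqr_ge0//.
by rewrite (bigD1 j)//= lerDl sumr_ge0// => i _; rewrite sqr_ge0.
Qed.

Lemma pnorm_eq0 x : pnorm x = 0 -> x = 0.
Proof.
case: x => z p x0; congr (_, _); apply/rowP => i; rewrite mxE; apply/eqP;
  rewrite -normr_le0 -x0;
  [exact: (norm_coord1_le (z, p))|exact: (norm_coord2_le (z, p))].
Qed.

(** A crude bound: it shows that the set whose supremum is the dual norm is
    bounded. *)
Lemma inner_le_sum_norm s x : inner s x <=
  (\sum_k `|s.1 0 k| + \sum_j `|s.2 0 j|) * pnorm x.
Proof.
rewrite mulrDl !mulr_suml; apply: lerD; apply: ler_sum => i _;
  apply: le_trans (ler_norm _) _; rewrite normrM ler_wpM2l//.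
  exact: norm_coord1_le.
exact: norm_coord2_le.
Qed.

Lemma inner_le_dual_norm1 s x : pnorm x <= 1 -> inner s x <= dual_norm s.
Proof.
move=> x1; apply: ub_le_sup; last by exists x.
exists (\sum_k `|s.1 0 k| + \sum_j `|s.2 0 j|) => _ [d /= d1 <-].
apply: le_trans (inner_le_sum_norm _ _) _.
by rewrite ler_piMr// addr_ge0// sumr_ge0.
Qed.

Lemma dual_norm_ge0 s : 0 <= dual_norm s.
Proof.
rewrite -[leLHS](mul0r (inner s 0)) -innerZr scale0r.
apply: inner_le_dual_norm1.
by rewrite -(scale0r 0) pnormZ normr0 mul0r.
Qed.

Lemma inner_le_dual_norm s x : inner s x <= dual_norm s * pnorm x.
Proof.
have [/pnorm_eq0 ->|x0] := eqVneq (pnorm x) 0.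
  by rewrite -(scale0r 0) innerZr pnormZ normr0 !mul0r mulr0.
have xgt0 : 0 < pnorm x by rewrite lt_def x0 pnorm_ge0.
rewrite -ler_pdivrMr// mulrC -innerZr; apply: inner_le_dual_norm1.
by rewrite pnormZ ger0_norm ?invr_ge0 ?pnorm_ge0// mulVf.
Qed.

Lemma norm_inner_le s x : `|inner s x| <= dual_norm s * pnorm x.
Proof.
rewrite ler_norml inner_le_dual_norm andbT lerNl -innerNr.
have -> : pnorm x = pnorm (- x) by rewrite -scaleN1r pnormZ normrN1 mul1r.
exact: inner_le_dual_norm.
Qed.

End Pairing.

(** * The descent lemma *)

(** Differentiability is relative to [0, 1]; it gives an ordinary derivative on
    the open interval and continuity up to the endpoints, which is what the mean
    value theorem requires. It is applied to f minus the quadratic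
    c 0 * t + K / 2 * t^2, whose derivative c 0 + K * t dominates c t. *)
Lemma line_descent (R : realType) (f c : R -> R) (K : R) :
  (forall t : R, t \in `[0, 1] -> forall eps : R, 0 < eps ->
     \forall u \near within `[0, 1] (nbhs t),
       `|f u - f t - c t * (u - t)| <= eps * `|u - t|) ->
  (forall t, t \in `[0, 1] -> c t - c 0 <= K * t) ->
  f 1 - f 0 - c 0 <= K / 2.
Proof.
move=> df cK.
pose q (t : R) := c 0 * t + K / 2 * t ^+ 2.
have dq (t : R) : is_derive t 1 q (c 0 + K * t).
  by apply: is_derive_eq; rewrite /GRing.scale/=; field.
have df' (t : R) : t \in `]0, 1[ -> is_derive t 1 f (c t).
  move=> t01.
  have t01' : t \in `[0, 1] by apply: subset_itv_oo_cc.
  have fc : (fun h : R => h^-1 *: ((f \o shift t) (h *: 1) - f t)) @ 0^' --> c t.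
    apply/cvgrPdist_le => eps eps0.
    (* near an interior point the restriction to [0, 1] is void *)
    have : \forall u \near t, u \in `[0, 1] /\
        `|f u - f t - c t * (u - t)| <= eps * `|u - t|.
      have := df t t01' eps eps0; rewrite near_withinE => dft.
      near=> u; have u01 : u \in `[0, 1].
        apply: subset_itv_oo_cc; near: u; exact: near_in_itvoo.
      by split=> //; move: u01; near: u.
    move=> /nbhs_ballP[e /= e0 He].
    apply/nbhs_ballP; exists e => // h /= he h0.
    rewrite /ball/= sub0r normrN in he.
    have [|_] := He (h + t).
      by rewrite /ball/= opprD addrCA subrr addr0 normrN.
    rewrite addrK /shift /= [h *: 1]mulr1 => Hh.
    rewrite distrC /GRing.scale/=.
    have -> : h^-1 * (f (h + t) - f t) - c t = h^-1 * (f (h + t) - f t - c t * h).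
      by field.
    rewrite normrM normfV mulrC ler_pdivrMr ?normr_gt0//.
  apply: DeriveDef; first by apply/cvg_ex; exists (c t).
  exact: cvg_lim.
have cf : {within `[0, 1], continuous f}.
  apply/subspace_continuousP => t t01.
  apply/cvgrPdist_le => eps eps0.
  pose C := 1 + `|c t|.
  have C0 : 0 < C by rewrite /C ltr_pwDl.
  have := df t t01 1 ltr01; rewrite !near_withinE => dft.
  near=> u => u01.
  have fu : `|f u - f t - c t * (u - t)| <= 1 * `|u - t|.
    by move: u01; near: u; apply: dft.
  have ut : `|t - u| <= eps / C.
    by near: u; apply: cvgr_dist_le => //; rewrite divr_gt0.
  rewrite distrC -(subrK (c t * (u - t)) (f u - f t)).
  apply: le_trans (ler_normD _ _) _.
  apply: (@le_trans _ _ (C * `|u - t|)).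
    by rewrite /C mulrDl lerD// normrM.
  by rewrite mulrC -ler_pdivlMr// distrC.
have cfq : {within `[0, 1], continuous (f - q)}.
  move=> x; apply: cvgB; first exact: cf.
  apply: continuous_subspaceT x => x.
  exact/differentiable_continuous/derivable1_diffP.
have [t t01] := MVT ltr01 (fun t ht => is_deriveB (df' t ht) (dq t)) cfq.
have := cK t (subset_itv_oo_cc t01).
rewrite /q /= !fctE; lra.
Unshelve. all: by end_near.
Qed.

(** [line_descent] for g along the segment t |-> y + t (x - y), and for - g to
    get the absolute value. *)
Lemma descent (R : realType) (n m : nat) (g : 'rV[R]_n * 'rV[R]_m -> R)
    (gradg : 'rV[R]_n * 'rV[R]_m -> 'rV[R]_n * 'rV[R]_m) (L : R)
    (Q : set ('rV[R]_n * 'rV[R]_m)) (x y : 'rV[R]_n * 'rV[R]_m) :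
  (forall t : R, t \in `[0, 1] -> y + t *: (x - y) \in Q) ->
  (forall z, z \in Q -> is_gradient_on Q g z (gradg z)) ->
  (forall z z', z \in Q -> z' \in Q ->
     dual_norm (gradg z - gradg z') <= L * pnorm (z - z')) ->
  `|g x - g y - inner (gradg y) (x - y)| <= L * (pnorm (x - y) ^+ 2 / 2).
Proof.
move=> segQ gd gl; pose w (t : R) := y + t *: (x - y).
have w0 : w 0 = y by rewrite /w scale0r addr0.
have w1 : w 1 = x by rewrite /w scale1r subrKC.
have wB t u : w u - w t = (u - t) *: (x - y).
  by rewrite /w opprD addrACA subrr add0r scalerBl.
pose c t := inner (gradg (w t)) (x - y).
have dg (t : R) : t \in `[0, 1] -> forall eps : R, 0 < eps ->
     \forall u \near within `[0, 1] (nbhs t),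
       `|g (w u) - g (w t) - c t * (u - t)| <= eps * `|u - t|.
  move=> t01 eps eps0.
  (* |w u - w t| = |u - t| * |x - y|; adding 1 avoids dividing by 0 if x = y *)
  pose N := `|x - y| + 1.
  have N0 : 0 < N by rewrite ltr_wpDl.
  have /eqoP/(_ (eps / N) (divr_gt0 eps0 N0)) := gd _ (segQ t t01).
  rewrite !near_withinE => gw.
  have cw : w u @[u --> t] --> w t.
    apply: cvgD; first exact: cvg_cst.
    by apply: cvgZl; exact: cvg_id.
  have {gw} gw := cw _ gw; rewrite nbhs_simpl/= in gw.
  apply: filterS gw => u /= + u01; rewrite -/(w t) wB innerZr -/(c t).
  move=> /(_ (set_mem (segQ u u01))); rewrite [_ * c t]mulrC => guw.
  apply: le_trans guw _.
  rewrite normrZ mulrCA mulrC ler_wpM2r// -mulrA ler_piMr ?(ltW eps0)//.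
  by rewrite mulrC ler_pdivrMr// mul1r lerDl.
have cK (t : R) : t \in `[0, 1] -> `|c t - c 0| <= L * pnorm (x - y) ^+ 2 * t.
  move=> t01; have t0 : 0 <= t by move: t01; rewrite in_itv => /andP[].
  rewrite /c -innerBl; apply: le_trans (norm_inner_le _ _) _.
  have := gl _ _ (segQ t t01) (segQ 0 _); rewrite -/(w t) -/(w 0) wB pnormZ.
  rewrite subr0 ger0_norm// => /(_ _)/(ler_wpM2r (pnorm_ge0 (x - y))) H.
  apply: le_trans (H _) _; first by rewrite in_itv/= lexx ler01.
  by rewrite [leRHS](_ : _ = L * (t * pnorm (x - y)) * pnorm (x - y)) //; ring.
have up := @line_descent R (g \o w) c (L * pnorm (x - y) ^+ 2) dg.
have lo := @line_descent R (fun t => - g (w t)) (fun t => - c t)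
  (L * pnorm (x - y) ^+ 2).
rewrite ler_norml mulrA; apply/andP; split.
  rewrite lerNl; apply: le_trans (lo _ _); last 2 first.
  - move=> t t01 eps eps0; apply: filterS (dg t t01 eps eps0) => u.
    by rewrite mulNr -!opprD normrN.
  - by move=> t /cK /ler_normlP[+ _]; rewrite opprB opprK addrC.
  by rewrite /c w0 w1; lra.
apply: le_trans (up _); first by rewrite /c /= w0 w1.
by move=> t /cK; apply: le_trans; exact: ler_norm.
Qed.

(** * Convexity of the model *)

Lemma domQ_convex (R : realType) (n m : nat) (x y : 'rV[R]_n * 'rV[R]_m)
    (s : R) :
  0 <= s <= 1 -> x \in domQ R n m -> y \in domQ R n m ->
  s *: x + (1 - s) *: y \in domQ R n m.
Proof.
move=> /andP[s0 s1]; rewrite !inE => -[[xz0 xz1] xp] [[yz0 yz1] yp].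
have s1' : 0 <= 1 - s by rewrite subr_ge0.
split; first split.
- by move=> k; rewrite !mxE addr_ge0// mulr_ge0.
- under eq_bigr do rewrite !mxE.
  by rewrite big_split/= -!mulr_sumr xz1 yz1 !mulr1 subrKC.
- by move=> j; rewrite !mxE addr_ge0// mulr_ge0.
Qed.

Lemma KL_const1 (R : realType) (n : nat) (z : 'rV[R]_n) :
  KL z (const_mx 1) = \sum_k z 0 k * ln (z 0 k).
Proof. by apply: eq_bigr => k _; rewrite mxE divr1. Qed.

Lemma KL_split (R : realType) (n : nat) (z t : 'rV[R]_n) :
  (forall k, 0 <= z 0 k) -> (forall k, 0 < t 0 k) ->
  KL z t = KL z (const_mx 1) - \sum_k z 0 k * ln (t 0 k).
Proof.
move=> z0 t0; rewrite KL_const1 -sumrB; apply: eq_bigr => k _.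
have := z0 k; rewrite le_eqVlt => /predU1P[<-|zk]; first by rewrite !mul0r subrr.
by rewrite ln_div ?posrE// mulrBr.
Qed.

Lemma norm2B_sqr (R : realType) (m : nat) (p q : 'rV[R]_m) :
  norm2 (p - q) ^+ 2 = norm2 p ^+ 2 - 2 * \sum_j p 0 j * q 0 j + norm2 q ^+ 2.
Proof.
rewrite !norm2_sqr mulr_sumr -sumrB -big_split/=; apply: eq_bigr => j _.
by rewrite !mxE; ring.
Qed.

(** The Bregman divergence V[y](.) differs from the entropy plus half the squared
    norm by an affine function, so subtracting Lg * V[y](.) only lowers the
    coefficients mu1 and mu2 by Lg, up to the affine part <v, x> + c. *)
Lemma psimu_split (R : realType) (n m : nat)
    (gradg : 'rV[R]_n * 'rV[R]_m -> 'rV[R]_n * 'rV[R]_m) (Lg mu1 mu2 : R)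
    (y : 'rV[R]_n * 'rV[R]_m) :
  (forall k, 0 < y.1 0 k) ->
  exists v c, forall x, x \in domQ R n m ->
    psimu gradg Lg mu1 mu2 x y = inner v x + c
      + (mu1 - Lg) * KL x.1 (const_mx 1) + (mu2 - Lg) / 2 * norm2 x.2 ^+ 2.
Proof.
move=> y0; pose ly := (\row_k ln (y.1 0 k), y.2) : 'rV[R]_n * 'rV[R]_m.
exists (gradg y + Lg *: ly).
exists (- inner (gradg y) y - Lg / 2 * norm2 y.2 ^+ 2 - mu1 * KL y.1 (const_mx 1)
        - mu2 / 2 * norm2 y.2 ^+ 2) => x; rewrite inE => -[[x0 _] _].
rewrite /psimu KL_split// norm2B_sqr innerBr ![inner _ x]innerC innerDr innerZr.
have -> : inner x ly = \sum_k x.1 0 k * ln (y.1 0 k) + \sum_j x.2 0 j * y.2 0 j.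
  by rewrite /inner; congr (_ + _); apply: eq_bigr => k _; rewrite mxE.
by field.
Qed.

Lemma convex_KL1 (R : realType) (n : nat) (s : R) (a b : 'rV[R]_n) :
  0 <= s <= 1 -> (forall k, 0 <= a 0 k) -> (forall k, 0 <= b 0 k) ->
  KL (s *: a + (1 - s) *: b) (const_mx 1) <=
  s * KL a (const_mx 1) + (1 - s) * KL b (const_mx 1).
Proof.
move=> s01 a0 b0; rewrite !KL_const1 !mulr_sumr -big_split/=.
by apply: ler_sum => k _; rewrite !mxE convex_xlnx.
Qed.

Lemma convex_norm2_sqr (R : realType) (m : nat) (s : R) (a b : 'rV[R]_m) :
  0 <= s <= 1 ->
  norm2 (s *: a + (1 - s) *: b) ^+ 2 <= s * norm2 a ^+ 2 + (1 - s) * norm2 b ^+ 2.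
Proof.
move=> s01; rewrite !norm2_sqr !mulr_sumr -big_split/=.
by apply: ler_sum => j _; rewrite !mxE convex_sqr.
Qed.

Lemma psimu_convex (R : realType) (n m : nat)
    (gradg : 'rV[R]_n * 'rV[R]_m -> 'rV[R]_n * 'rV[R]_m) (Lg mu1 mu2 : R)
    (y : 'rV[R]_n * 'rV[R]_m) :
  Lg <= mu1 -> Lg <= mu2 -> (forall k, 0 < y.1 0 k) ->
  convex_function (E := ('rV[R]_n * 'rV[R]_m)%type) (domQ R n m)
    ((psimu gradg Lg mu1 mu2)^~ y).
Proof.
move=> L1 L2 y0 t a b aQ bQ; rewrite convRE.
have [v [c psiE]] := psimu_split gradg Lg mu1 mu2 y0.
pose s : R := t%:num.
have s01 : 0 <= s <= 1 by rewrite /s; apply/andP; split.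
(* unfold the convex-space operation into an explicit linear combination *)
change (psimu gradg Lg mu1 mu2
  (s *: (a : 'rV[R]_n * 'rV[R]_m) + (1 - s) *: (b : 'rV[R]_n * 'rV[R]_m)) y <=
  s * psimu gradg Lg mu1 mu2 a y + (1 - s) * psimu gradg Lg mu1 mu2 b y).
rewrite !psiE//; last exact: domQ_convex.
have [[a0 _] _] := set_mem aQ; have [[b0 _] _] := set_mem bQ.
have d1 : 0 <= mu1 - Lg by rewrite subr_ge0.
have d2 : 0 <= (mu2 - Lg) / 2 by rewrite divr_ge0// subr_ge0.
have cKL := ler_wpM2l d1 (convex_KL1 s01 a0 b0).
have cn2 := ler_wpM2l d2 (convex_norm2_sqr a.2 b.2 s01).
rewrite innerDr !innerZr; lra.
Qed.

(** * The model inequality *)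

Lemma half_sqr_pnorm_le_bregman (R : realType) (n m : nat)
    (x y : 'rV[R]_n * 'rV[R]_m) :
  x \in domQ R n m -> y \in domQ R n m -> (forall k, 0 < y.1 0 k) ->
  pnorm (x - y) ^+ 2 / 2 <= bregman y x.
Proof.
move=> /set_mem[xz _] /set_mem[yz _] y0.
by rewrite pnorm_sqr mulrDl lerD2r pinsker// inE.
Qed.

Lemma bregman_id (R : realType) (n m : nat) (x : 'rV[R]_n * 'rV[R]_m) :
  bregman x x = 0.
Proof.
rewrite /bregman KL_id subrr norm2_sqr big1 ?mul0r ?addr0// => j _.
by rewrite mxE expr0n.
Qed.

Theorem mainTheorem5 (R : realType) (n m : nat)
    (g : 'rV[R]_n * 'rV[R]_m -> R)
    (gradg : 'rV[R]_n * 'rV[R]_m -> 'rV[R]_n * 'rV[R]_m)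
    (Lg mu1 mu2 : R)
    (g_diff : forall x, x \in domQ R n m ->
       is_gradient_on (domQ R n m) g x (gradg x))
    (g_lip : forall x y, x \in domQ R n m -> y \in domQ R n m ->
       dual_norm (gradg x - gradg y) <= Lg * pnorm (x - y))
    (Lg_mu1 : Lg <= mu1) (Lg_mu2 : Lg <= mu2)
    (y : 'rV[R]_n * 'rV[R]_m)
    (yQ : y \in domQ R n m) (y_gt0 : forall k, 0 < y.1 0 k) :
  is_model (domQ R n m) (@bregman R n m) 0 (2 * Lg)
    (fmu g mu1 mu2) (psimu gradg Lg mu1 mu2) y.
Proof.
split; first exact: psimu_convex.
  move=> x _; have dx : norm2 (x.2 - x.2) ^+ 2 = 0.
    by have := bregman_id x; rewrite /bregman KL_id; lra.
  by rewrite /psimu KL_id innerBr dx; ring.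
move=> x xQ.
have -> : fmu g mu1 mu2 x - (fmu g mu1 mu2 y + psimu gradg Lg mu1 mu2 x y) =
    g x - g y - inner (gradg y) (x - y) + Lg * bregman y x.
  by rewrite /fmu /psimu /bregman !KL_const1; field.
have seg (t : R) : t \in `[0, 1] -> y + t *: (x - y) \in domQ R n m.
  rewrite in_itv/= => t01; have -> : y + t *: (x - y) = t *: x + (1 - t) *: y.
    by rewrite scalerBr scalerBl scale1r addrCA.
  exact: domQ_convex.
have := descent seg g_diff g_lip.
have : Lg * (pnorm (x - y) ^+ 2 / 2) <= Lg * bregman y x.
  have [xy|xy] := eqVneq (pnorm (x - y)) 0.
    have /eqP := pnorm_eq0 xy; rewrite subr_eq0 => /eqP ->.
    by rewrite bregman_id subrr -(scale0r 0) pnormZ normr0 mul0r expr0n mul0r.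
  (* 0 <= dual norm <= Lg * pnorm (x - y) with pnorm (x - y) > 0 *)
  apply: ler_wpM2l; last exact: half_sqr_pnorm_le_bregman.
  have xy0 : 0 < pnorm (x - y) by rewrite lt_def xy pnorm_ge0.
  by rewrite -(pmulr_lge0 _ xy0); apply: le_trans (dual_norm_ge0 _) (g_lip _ _ xQ yQ).
rewrite ler_norml => LV /andP[lo up]; apply/andP; split; lra.
Qed.
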